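(* Let $T\ge 1$ and $n_1,\ldots,n_T\ge 1$ be integers, $n=n_1+\cdots+n_T$, and let $z_1,z_2,\ldots$ be positive real numbers, $y_i=z_1+\cdots+z_i$. Consider the Multispecies Juggling Markov Chain (MSJMC) on $St_{n_1,\ldots,n_T}$ described in the context. Its stationary distribution $\pi$ is given, for $w\in St_{n_1,\ldots,n_T}$, by $$\pi(w)=\frac{1}{Z}\prod_{i=1}^n y_{E_w(i)},\qquad E_w(i)=1+\#\{j:\ i\le j\le n,\ w_j>w_i\},$$ where $$Z=\prod_{i=1}^T h_{n_i}\bigl(y_1,\ldots,y_{n-n_1-\cdots-n_i+1}\bigr),$$ with $h_\ell$ the complete homogeneous symmetric polynomial of degree $\ell$.
   Context: State space: $St_{n_1,\ldots,n_T}$ is the set of words $w=w_1\cdots w_n$ over $\{1,\ldots,T\}$ containing exactly $n_i$ occurrences of the letter $i$ for each $i$. Convention: $w_{n+1}=\infty$. For $m\in\{1,\ldots,n+1\}$ and $t\in\{1,\ldots,T\}$ set $J_w(m,t)=1+\#\{\ell:\ m\le\ell\le n,\ w_\ell>t\}$. A bumping sequence for $w$ is an increasing sequence of integers $a(1)<\cdots<a(k)$ with $a(1)=1$, $a(k)=n+1$ and $w_{a(j)}<w_{a(j+1)}$ for all $1\le j\le k-1$. For such $a$, the word $w^a$ is defined by $w^a_i=w_{a(\ell-1)}$ if $i=a(\ell)-1$ for some $\ell\in\{2,\ldots,k\}$, and $w^a_i=w_{i+1}$ otherwise ($1\le i\le n$); it lies in $St_{n_1,\ldots,n_T}$. The transition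 probability from $w$ to $w'$ is $\prod_{i=2}^k \dfrac{z_{J_w(a(i),w_{a(i-1)})}}{y_{J_w(a(i-1),w_{a(i-1)})}}$ if $w'=w^a$ for a (necessarily unique) bumping sequence $a$ of $w$, and $0$ otherwise. *)

(* Defs.v *)
From HB Require Import structures.
From mathcomp Require Import all_boot all_order all_algebra.

Set Implicit Arguments.
Unset Strict Implicit.
Unset Printing Implicit Defensive.

Import Order.TTheory GRing.Theory Num.Theory.

(* Conventions: the letters 1, ..., T are coded by 'I_T, the letter t being the
   ordinal of value t - 1.  Positions in words and indices of the parameters
   z_i, y_i are 1-based natural numbers (z 0 is never used). *)

(* w_m for 1 <= m <= n + 1, where n is the size of w; the default value T plays
   the role of w_{n+1} = oo, as it is larger than the code of every letter. *)
Definition letter (T : nat) (w : seq 'I_T) (m : nat) : nat :=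
  nth T [seq nat_of_ord t | t <- w] m.-1.

Definition J_ (T : nat) (w : seq 'I_T) (m t : nat) : nat :=
  (count (fun l => t < letter w l) (index_iota m (size w).+1)).+1.

Definition E_ (T : nat) (w : seq 'I_T) (i : nat) : nat :=
  (count (fun j => letter w i < letter w j) (index_iota i (size w).+1)).+1.

(* The item a(j) of a sequence, for 1 <= j <= size a. *)
Definition item (a : seq nat) (j : nat) : nat := nth 0 a j.-1.

(* [sorted r a] says that r holds between any two consecutive items of a. *)
Definition bumping (T : nat) (w : seq 'I_T) (a : seq nat) : bool :=
  [&& head 0 a == 1, last 0 a == (size w).+1, sorted ltn a
    & sorted (fun p q => letter w p < letter w q) a].

(* The word w^a, as the sequence of its letter codes.  If i + 1 = a(l) with
   l >= 2, then the index of i + 1 in [behead a], which counts from 0, is l - 2. *)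
Definition bumped (T : nat) (w : seq 'I_T) (a : seq nat) : seq nat :=
  [seq if i.+1 \in behead a then letter w (item a (index i.+1 (behead a)).+1)
       else letter w i.+1 | i <- iota 1 (size w)].

Definition bumping_seqs (T : nat) (w : seq 'I_T) : seq (seq nat) :=
  [seq a <- [seq mask (val m) (iota 1 (size w).+1)
            | m <- enum {: (size w).+1.-tuple bool}] | bumping w a].

Lemma bumping_mem_iota (T : nat) (w : seq 'I_T) (a : seq nat) :
  bumping w a -> {subset a <= iota 1 (size w).+1}.
Proof.
move=> + u; rewrite mem_iota; case/and4P; case: a => [//|x a].
move=> /eqP /= -> /eqP la lt_a _; rewrite inE => /predU1P[-> //|ua].
move: (lt_a); rewrite path_sortedE; last exact: ltn_trans.
case/andP=> /allP /(_ u ua) gt1 _; rewrite ltnW //= add1n ltnS -la.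
case/splitPr: ua lt_a => p1 p2; rewrite cat_path last_cat /= => /and3P[_ _].
rewrite path_sortedE; last exact: ltn_trans.
case/andP=> /allP H _; case: p2 H => [//|v p2] H /=.
by apply/ltnW/H; exact: mem_last.
Qed.

Lemma mem_bumping_seqs (T : nat) (w : seq 'I_T) (a : seq nat) :
  (a \in bumping_seqs w) = bumping w a.
Proof.
rewrite mem_filter andb_idr // => ba; have sub_a := bumping_mem_iota ba.
have lt_a : sorted ltn a by case/and4P: ba.
have -> : a = filter (mem a) (iota 1 (size w).+1).
  apply: (irr_sorted_eq ltn_trans ltnn lt_a).
    by apply: sorted_filter; [exact: ltn_trans | exact: iota_ltn_sorted].
  by move=> u; rewrite mem_filter andb_idr //=; exact: sub_a.
rewrite filter_mask; apply/mapP.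
have sz : size (map (mem a) (iota 1 (size w).+1)) == (size w).+1.
  by rewrite size_map size_iota.
by exists (Tuple sz); rewrite ?mem_enum.
Qed.

Lemma bumped_inj (T : nat) (w : seq 'I_T) (a b : seq nat) :
  bumping w a -> bumping w b -> bumped w a = bumped w b -> a = b.
Proof.
have sub c d : bumping w c -> bumping w d -> bumped w c = bumped w d ->
    {subset c <= d}.
  move=> bc bd /eq_in_map eq_cd u uc; apply/negPn/negP => ud.
  have := bumping_mem_iota bc uc; rewrite mem_iota add1n ltnS.
  case/and4P: (bd) => /eqP hd _ _ _; case/and4P: (bc) => /eqP hc _ _ /(sortedP 0) ltc.
  case: c hc uc eq_cd {bc} ltc => [//|x c] /= -> uc eq_cd ltc.
  move: uc; rewrite inE => /predU1P[u1|uc].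
    by move: ud; rewrite u1; case: d hd {bd eq_cd} => [//|? ?] /= ->; rewrite mem_head.
  case: u ud uc => [|u] ud uc; first by [].
  case: u ud uc => [|u] ud uc.
    by move: ud; case: d hd {bd eq_cd} => [//|? ?] /= ->; rewrite mem_head.
  move=> /andP[_ ltu].
  have := eq_cd u.+1; rewrite mem_iota add1n ltu => /(_ isT).
  have /negPf-> : u.+2 \notin behead d.
    by apply: contra ud; exact: mem_behead.
  rewrite uc /item /= => eq_l.
  have := ltc (index u.+2 c); rewrite ltnS index_mem => /(_ uc) /=.
  by rewrite nth_index // eq_l ltnn.
move=> ba bb e; apply: (irr_sorted_eq ltn_trans ltnn).
- by case/and4P: ba.
- by case/and4P: bb.
- by move=> u; apply/idP/idP; apply: sub.
Qed.

(* St_{c_1, ..., c_T}, where c t is the prescribed number of occurrences of t. *)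
Definition St (T : nat) (c : 'I_T -> nat) : finType :=
  {w : (\sum_t c t).-tuple 'I_T | [forall t, count_mem t w == c t]}.

Definition word (T : nat) (c : 'I_T -> nat) (w : St c) : seq 'I_T := val (val w).

Local Open Scope ring_scope.

Definition ysum (R : realFieldType) (z : nat -> R) (i : nat) : R :=
  \sum_(1 <= j < i.+1) z j.

Definition bump_weight (R : realFieldType) (z : nat -> R) (T : nat)
    (w : seq 'I_T) (a : seq nat) : R :=
  \prod_(2 <= i < (size a).+1)
    (z (J_ w (item a i) (letter w (item a i.-1)))
     / ysum z (J_ w (item a i.-1) (letter w (item a i.-1)))).

(* The filtered list has at most one item up to repetition, by [bumped_inj];
   all its items are bumping sequences, by [mem_bumping_seqs]. *)
Definition transition (R : realFieldType) (z : nat -> R) (T : nat)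
    (c : 'I_T -> nat) (w w' : St c) : R :=
  if [seq a <- bumping_seqs (word w)
     | bumped (word w) a == [seq nat_of_ord t | t <- word w']] is a :: _
  then bump_weight z (word w) a else 0.

Definition stationary_distribution (R : realFieldType) (S : finType)
    (P : S -> S -> R) (pi : S -> R) : Prop :=
  [/\ forall x, 0 <= pi x,
      \sum_x pi x = 1
    & forall x', \sum_x pi x * P x x' = pi x'].

(* h_l(x_1, ..., x_m): sum over 1 <= i_1 <= ... <= i_l <= m of the products
   x_{i_1} ... x_{i_l}, the indices being coded by 'I_m with a shift by one. *)
Definition hsym (R : realFieldType) (l m : nat) (x : nat -> R) : R :=
  \sum_(s : l.-tuple 'I_m | sorted leq [seq nat_of_ord i | i <- s])
    \prod_(i <- s) x i.+1.

Definition Zpart (R : realFieldType) (z : nat -> R) (T : nat)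
    (c : 'I_T -> nat) : R :=
  \prod_(i < T)
    hsym (c i) (\sum_t c t - \sum_(t < T | t <= i) c t).+1%N (ysum z).

(* Main.v *)
Require Import Defs.
From mathcomp Require Import all_boot all_order all_algebra.

Set Implicit Arguments.
Unset Strict Implicit.
Unset Printing Implicit Defensive.

Import Order.TTheory GRing.Theory Num.Theory.

Local Open Scope ring_scope.

(* Write [W(w)] for the product of the [y_{E_w(i)}].  In [W(w) P(w, w^a)] the
   denominators cancel against the factors of [W(w)] at the positions of [a].
   For a fixed target [u], the pairs [(w, a)] with [w^a = u] are produced by
   reading [u] from right to left with a carried letter, which at each step is
   kept or, if it is larger than the letter read, exchanged with it; the weights
   of the possible choices always add up to [y_E], [E = E_u(i)] (as
   [y_{E-1} + z_E] when the exchange is possible), so the sum over all pairs is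
   [W(u)].
   Normalization: the sum of [W] over the words of a given content satisfies the
   first-letter recursion, and so does the product of the [h]'s, by telescoping
   [h_l(y_1..y_m) - h_l(y_1..y_{m-1}) = y_m h_{l-1}(y_1..y_m)].
   Uniqueness: the minimizers of [pi / W] are closed under predecessors.
   Exchanging whenever possible gives a predecessor of [u] which is one bubble
   sort pass of [u], so the sorted word is a minimizer, and also a maximizer. *)

(** * Position statistics under removal of the first or second letter *)

Section Positions.

Variable T : nat.
Implicit Types (w r : seq 'I_T) (c m : 'I_T) (a : seq nat) (p t : nat).

Lemma letter_cons m w p : (0 < p)%N -> letter (m :: w) p.+1 = letter w p.
Proof. by case: p. Qed.

Lemma letter_cons2 c m r p :
  (1 < p)%N -> letter (c :: m :: r) p.+1 = letter (c :: r) p.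
Proof. by case: p => [|[|p]]. Qed.

Lemma J_cons m w p t : (0 < p)%N -> J_ (m :: w) p.+1 t = J_ w p t.
Proof.
move=> p_gt0; rewrite /J_ /index_iota subSS -[p.+1]addn1 addnC iotaDl count_map.
congr _.+1; apply: eq_in_count => l; rewrite mem_iota => /andP[pl _] /=.
by rewrite letter_cons // (leq_trans p_gt0).
Qed.

Lemma J_cons2 c m r p t :
  (1 < p)%N -> J_ (c :: m :: r) p.+1 t = J_ (c :: r) p t.
Proof. by case: p => [|[|p]] // _; rewrite !J_cons. Qed.

Lemma J_1 w t : J_ w 1 t = (count (fun x : 'I_T => t < x)%N w).+1.
Proof.
elim: w => [//|m w IH]; move: (IH); rewrite /J_ => -[{}IH].
have := J_cons m w t (ltn0Sn 0); rewrite /J_ => -[E].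
by rewrite /index_iota subn1 /= -IH -E /index_iota subSS subn1.
Qed.

Lemma E_J w p : E_ w p = J_ w p (letter w p).
Proof. by []. Qed.

End Positions.

(** * Recursive forms of [W] and of the bumping weights *)

Section Weights.

Variables (R : realFieldType) (z : nat -> R) (T : nat).
Implicit Types (w r u : seq 'I_T) (c m x : 'I_T) (a : seq nat) (p t : nat).

Definition above x w : nat := count (fun y : 'I_T => x < y)%N w.

Fixpoint wt w : R :=
  if w is x :: r then ysum z (above x r).+1 * wt r else 1.

Lemma prod_E w : \prod_(1 <= i < (size w).+1) ysum z (E_ w i) = wt w.
Proof.
elim: w => [|m w IH] /=; first by rewrite big_geq.
rewrite big_nat_recl //= -IH; congr (_ * _).
  by rewrite E_J J_1 /= ltnn.
rewrite !big_nat; apply: eq_bigr => i /andP[i_gt0 _].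
by rewrite !E_J letter_cons // J_cons.
Qed.

(** Here [p] is the item just before [a]; pairing consecutive items allows induction along the
    sequence. *)
Fixpoint path_weight w p a : R :=
  if a is q :: a' then
    z (J_ w q (letter w p)) / ysum z (J_ w p (letter w p)) * path_weight w q a'
  else 1.

Lemma bump_weight_path w p a : bump_weight z w (p :: a) = path_weight w p a.
Proof.
rewrite /bump_weight; elim: a p => [|q a IH] p; first by rewrite big_geq.
rewrite [size _]/= big_nat_recl // [path_weight _ _ _]/= -IH; congr (_ * _).
by rewrite !big_nat; apply: eq_bigr => -[|[|i]].
Qed.

Lemma path_weight_cons m w p a : all (leq 1) (p :: a) ->
  path_weight (m :: w) p.+1 (map S a) = path_weight w p a.
Proof.
elim: a p => [//|q a IH] p /= /and3P[p1 q1 a1].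
by rewrite IH /= ?q1 // letter_cons // !J_cons.
Qed.

Lemma path_weight_cons2 c m r p a : all (leq 2) (p :: a) ->
  path_weight (c :: m :: r) p.+1 (map S a) = path_weight (c :: r) p a.
Proof.
elim: a p => [//|q a IH] p /= /and3P[p1 q1 a1].
by rewrite IH /= ?q1 // letter_cons2 // !J_cons2.
Qed.

End Weights.

(** * Decomposition of bumping sequences at position 2 *)

Section BumpingSteps.

Variable T : nat.
Implicit Types (w r u : seq 'I_T) (c m x : 'I_T) (a b : seq nat) (p t : nat).

Lemma bumpingE c r a : bumping (c :: r) a =
  if a is p :: b then
    [&& p == 1, last 1 b == (size r).+2, path ltn 1 b
      & path (fun p q => letter (c :: r) p < letter (c :: r) q)%N 1 b]
  else false.
Proof.
by case: a => [//|p b]; rewrite /bumping /=; case: eqP => //= ->.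
Qed.

Lemma path_letter_cons m w p b : all (leq 1) (p :: b) ->
  path (fun p q => letter (m :: w) p < letter (m :: w) q)%N p.+1 (map S b) =
  path (fun p q => letter w p < letter w q)%N p b.
Proof.
elim: b p => [//|q b IH] p /= /and3P[p1 q1 b1].
by rewrite IH /= ?q1 // !letter_cons.
Qed.

Lemma path_letter_cons2 c m r p b : all (leq 2) (p :: b) ->
  path (fun p q => letter (c :: m :: r) p < letter (c :: m :: r) q)%N
       p.+1 (map S b) =
  path (fun p q => letter (c :: r) p < letter (c :: r) q)%N p b.
Proof.
elim: b p => [//|q b IH] p /= /and3P[p1 q1 b1].
by rewrite IH /= ?q1 // !letter_cons2.
Qed.

Lemma path_ltn_S p b : path ltn p.+1 (map S b) = path ltn p b.
Proof. by elim: b p => [//|q b IH] p /=; rewrite IH. Qed.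

Lemma path_ltn_all p b : path ltn p b -> all (leq p.+1) b.
Proof. by move/(order_path_min ltn_trans). Qed.

Lemma map_S_pred b : all (leq 1) b -> map S (map predn b) = b.
Proof. by elim: b => [//|[//|q] b IH] /= /IH ->. Qed.

Lemma last_S p b : last p.+1 (map S b) = (last p b).+1.
Proof. exact: last_map. Qed.

Lemma bumping_nonnil c r b : bumping (c :: r) (1%N :: b) -> b != [::].
Proof. by rewrite bumpingE; case: b. Qed.

(** When position 2 is avoided, [m] enters no comparison and can be deleted, later positions moving
    down by one. *)
Lemma bumping_skip c m r b : all (leq 3) b ->
  bumping (c :: m :: r) (1%N :: b) = bumping (c :: r) (1%N :: map predn b).
Proof.
move=> b3; have b1 : all (leq 1) b by apply: sub_all b3 => i; case: i.
have {b1 b3} [b0 b2 ->] : exists2 b0, all (leq 2) b0 & b = map S b0.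
  exists (map predn b); last by rewrite map_S_pred.
  by rewrite all_map; apply: sub_all b3 => -[].
rewrite (mapK (g := predn)) // !bumpingE; case: b0 b2 => [//|q b0] /= /andP[q2 b2].
rewrite path_ltn_S last_S eqSS path_letter_cons2 /= ?q2 // letter_cons2 // !ltnS.
by congr [&& _, (_ && _) & _]; case: q q2 {b2} => [|[]].
Qed.

Lemma bumping_bump c m r a : bumping (c :: m :: r) (1%N :: map S a) ->
   head 0%N a = 1%N -> (c < m)%N /\ bumping (m :: r) a.
Proof.
rewrite !bumpingE; case: a => [//|p b] /= + p1; rewrite {p}p1 last_S eqSS /=.
case/and4P=> -> lt_b cm; rewrite path_ltn_S in lt_b; rewrite path_letter_cons.
  by rewrite lt_b => ->.
by rewrite /=; apply: sub_all (path_ltn_all lt_b) => -[].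
Qed.

Lemma bump_bumping c m r a : (c < m)%N -> bumping (m :: r) a ->
  bumping (c :: m :: r) (1%N :: map S a).
Proof.
rewrite !bumpingE; case: a => [//|p b] cm /= /and4P[/eqP -> lb lt_b l_b].
rewrite last_S eqSS lb path_ltn_S lt_b path_letter_cons ?l_b /= ?andbT //.
by apply: sub_all (path_ltn_all lt_b) => -[].
Qed.

(** The two possible starts: the carried letter [c] flies over [m], or it lands at position 2 and
    [m] is carried on. *)
Variant bumping_spec c m r : seq nat -> Prop :=
  | BumpingSkip b of bumping (c :: r) (1%N :: b) & all (leq 2) b :
      bumping_spec c m r (1%N :: map S b)
  | BumpingBump b of (c < m)%N & bumping (m :: r) (1%N :: b) & all (leq 2) b :
      bumping_spec c m r (1%N :: map S (1%N :: b)).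

Lemma bumping_tail_ge2 c r b : bumping (c :: r) (1%N :: b) -> all (leq 2) b.
Proof. by rewrite bumpingE => /and4P[_ _ /path_ltn_all]. Qed.

Lemma bumpingP c m r a : bumping (c :: m :: r) a -> bumping_spec c m r a.
Proof.
case: a => [//|p b] ba; have p1 : p = 1%N by case/and4P: ba => /eqP.
move: ba; rewrite {p}p1 => ba; have b2 := bumping_tail_ge2 ba.
have b1 : all (leq 1) b by apply: sub_all b2 => -[].
case: b ba b2 b1 => [//|q b] ba /=; case/andP=> q2 b2 /andP[q1 b1].
have lt_b : path ltn q b by move: ba; rewrite bumpingE /= => /and3P[_ /andP[_ ?] _].
case: (q =P 2) => [q_2|/eqP q_n2].
  rewrite -(map_S_pred b1) q_2; move: ba; rewrite -{1}(map_S_pred b1) q_2.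
  rewrite -(map_cons S 1) => ba.
  case/bumping_bump: (ba) => // cm bm; apply: BumpingBump => //.
  exact: bumping_tail_ge2 bm.
have b3 : all (leq 3) (q :: b).
  rewrite /= ltn_neqAle eq_sym q_n2 q2 /=.
  by apply: sub_all (path_ltn_all lt_b) => i; apply: leq_trans; rewrite ltnS.
rewrite bumping_skip // in ba; have -> : q :: b = map S (map predn (q :: b)).
  by rewrite map_S_pred //= q1.
by apply: BumpingSkip => //; exact: bumping_tail_ge2 ba.
Qed.

Lemma bumping1 c a : bumping [:: c] a -> a = [:: 1; 2]%N.
Proof.
rewrite bumpingE; case: a => [//|p [|q b]] /and4P[/eqP -> // /eqP lb].
rewrite /= => /andP[q1 lt_b] _; case: b lb lt_b => [/= -> //|q' b] lb.
move/path_ltn_all/allP/(_ _ (mem_last q' b)).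
rewrite -[last q' b]/(last 1 [:: q, q' & b]) lb.
by rewrite ltnNge q1.
Qed.

Lemma skip_bumping c m r b : bumping (c :: r) (1%N :: b) ->
  bumping (c :: m :: r) (1%N :: map S b).
Proof.
move=> bb; have b2 := bumping_tail_ge2 bb.
by rewrite bumping_skip ?(mapK (g := predn)) // all_map.
Qed.

Lemma bumped_cons w a : (0 < size w)%N ->
  bumped w a =
  (if 2 \in behead a then letter w (item a (index 2 (behead a)).+1)
   else letter w 2)
  :: [seq if i.+2 \in behead a then letter w (item a (index i.+2 (behead a)).+1)
          else letter w i.+2 | i <- iota 1 (size w).-1].
Proof.
rewrite /bumped; case: (size w) => //= k _; congr (_ :: _).
by rewrite (iotaDl 1 1) -map_comp.
Qed.

Lemma index_map_S p b : index p.+1 (map S b) = index p b.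
Proof. by rewrite index_map //; exact: succn_inj. Qed.

Lemma mem_map_S p b : (p.+1 \in map S b) = (p \in b).
Proof. by rewrite mem_map //; exact: succn_inj. Qed.

Lemma bumped_skip c m r b : all (leq 2) b ->
  bumped (c :: m :: r) (1%N :: map S b) =
  val m :: bumped (c :: r) (1%N :: b).
Proof.
move=> b2; rewrite bumped_cons // -[(size _).-1]/(size (c :: r)) [behead _]/=.
congr (_ :: _).
  by rewrite mem_map_S; case: ifP => // /(allP b2).
apply/eq_in_map => i; rewrite mem_iota => /andP[i1 _].
rewrite mem_map_S index_map_S letter_cons2 ?ltnS //; case: ifP => // ib.
rewrite /item /=; have := ib; rewrite -index_mem.
(* Index 0 means that the letter placed is [c], first in both words; otherwise it comes from a
   position at least 2 of [c :: r], where [letter_cons2] applies. *)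
case E : (index _ _) => [//|k] lt_k /=.
have lt_k' : (k < size b)%N := ltnW lt_k.
by rewrite (nth_map 0%N) // letter_cons2 //; apply: (allP b2); rewrite mem_nth.
Qed.

Lemma bumped_bump c m r b : all (leq 2) b ->
  bumped (c :: m :: r) (1%N :: map S (1%N :: b)) =
  val c :: bumped (m :: r) (1%N :: b).
Proof.
move=> b2; rewrite bumped_cons // -[(size _).-1]/(size (m :: r)) [behead _]/=.
congr (_ :: _).
apply/eq_in_map => i; rewrite mem_iota => /andP[i1 _].
rewrite inE mem_map_S /= index_map_S !eqSS gtn_eqF // ltn_eqF // letter_cons //=.
case: ifP => // ib.
rewrite /item /=; have := ib; rewrite -index_mem.
case E : (index _ _) => [//|k] lt_k /=.
have lt_k' : (k < size b)%N := ltnW lt_k.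
rewrite (nth_map 0%N) // letter_cons //.
by apply: ltnW; apply: (allP b2); rewrite mem_nth.
Qed.

End BumpingSteps.

(** * Weight sent from a word to a target word *)

Section Flow.

Variables (R : realFieldType) (z : nat -> R) (T : nat).
Hypothesis z_gt0 : forall i : nat, (0 < i)%N -> 0 < z i.
Implicit Types (w r u : seq 'I_T) (c m x : 'I_T) (a b : seq nat) (p t : nat).

Lemma ysum1 : ysum z 1 = z 1.
Proof. by rewrite /ysum big_nat1. Qed.

Lemma ysumS i : ysum z i.+1 = ysum z i + z i.+1.
Proof. by rewrite /ysum big_nat_recr. Qed.

Lemma ysum_gt0 i : 0 < ysum z i.+1.
Proof.
elim: i => [|i IH]; first by rewrite ysum1 z_gt0.
by rewrite ysumS addr_gt0 ?z_gt0.
Qed.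

Lemma wt_gt0 w : 0 < wt z w.
Proof. by elim: w => [|x w IH] /=; rewrite ?ltr01 ?mulr_gt0 ?ysum_gt0. Qed.

(* [flow c r u] is [wt (c :: r)] times the probability of moving from [c :: r]
   to [u]. *)
Fixpoint flow c r u : R :=
  match r, u with
  | [::], [:: x] => if x == c then z 1 else 0
  | m :: r', x :: u' =>
      if x == m then ysum z (above m r').+1 * flow c r' u'
      else if (x == c) && (c < m)%N then z (above c r).+1 * flow m r' u'
      else 0
  | _, _ => 0
  end.

Lemma flow_ge0 c r u : 0 <= flow c r u.
Proof.
elim: r c u => [|m r IH] c [|x u] //=.
  by case: u => //; case: eqP => // _; rewrite ltW ?z_gt0.
case: eqP => _; first by rewrite mulr_ge0 // ltW ?ysum_gt0.
by case: andP => // _; rewrite mulr_ge0 // ltW ?z_gt0.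
Qed.

(** Both branches only move letters. This confines the flow to one state space and identifies the
    letter counts in [sum_flow]. *)
Lemma perm_flow c r u : flow c r u != 0 -> perm_eq (c :: r) u.
Proof.
elim: r c u => [|m r IH] c [|x u] //=; rewrite ?eqxx //.
  by case: u => [|? ?]; rewrite ?eqxx //; case: (x =P c) => [->|]; rewrite ?eqxx.
case: (x =P m) => [->|_].
  rewrite mulf_eq0 negb_or => /andP[_ /IH].
  by rewrite -(perm_cons m); apply: perm_trans; rewrite (perm_catCA [:: c] [:: m]).
case: andP => [[/eqP -> _]|]; rewrite ?eqxx // mulf_eq0 negb_or => /andP[_ /IH].
by rewrite perm_cons.
Qed.

Lemma mul_div_cancel (A X Y P : R) :
  A != 0 -> A * X * (Y / A * P) = Y * (X * P).
Proof. by move=> A0; rewrite mulrACA [A * _]mulrC divfK. Qed.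

(** The denominator of the first hop is the head factor of [wt]. Deleting [m] may change it, but it
    cancels in either word, so only the factor of [m] remains. *)
Lemma wt_skip c m r b : bumping (c :: r) (1%N :: b) -> all (leq 2) b ->
  wt z (c :: m :: r) * bump_weight z (c :: m :: r) (1%N :: map S b) =
  ysum z (above m r).+1 * (wt z (c :: r) * bump_weight z (c :: r) (1%N :: b)).
Proof.
move=> /bumping_nonnil; case: b => [//|q b] _ b2; rewrite !bump_weight_path.
rewrite [map _ _]/= /path_weight -!/(path_weight _ _ _ _) path_weight_cons2 //.
have q2 : (1 < q)%N by case/andP: b2.
rewrite J_cons2 // !J_1 /= !ltnn !add0n -!/(above _ _).
rewrite !mul_div_cancel ?lt0r_neq0 ?ysum_gt0 //.
by rewrite -!mulrA mulrCA.
Qed.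

(** Only the numerator of the hop from 1 to 2 survives: its denominator is the factor of [c] in
    [wt]. *)
Lemma wt_bump c m r b : all (leq 2) b ->
  wt z (c :: m :: r) * bump_weight z (c :: m :: r) (1%N :: map S (1%N :: b)) =
  z (above c (m :: r)).+1 *
  (wt z (m :: r) * bump_weight z (m :: r) (1%N :: b)).
Proof.
move=> b2; rewrite !bump_weight_path [map _ _]/=.
have b1 : all (leq 1) (1%N :: b) by apply: sub_all b2 => -[].
rewrite {1}/path_weight -!/(path_weight _ _ _ _) path_weight_cons // J_cons // !J_1.
have -> : letter (c :: m :: r) 1 = c by [].
rewrite [wt z (c :: _)]/= [count _ (c :: _)]/= ltnn add0n.
rewrite -/(above c (m :: r)) -/(wt z (m :: r)).
by rewrite mul_div_cancel // lt0r_neq0 ?ysum_gt0.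
Qed.

(** The first letter of [u] tells the two shapes apart: flying over [m] writes [m], landing there
    writes [c], and [c < m] makes these differ. *)
Lemma flowP c r u : size u = (size r).+1 ->
  (exists2 a, bumping (c :: r) a /\ bumped (c :: r) a = map val u
     & wt z (c :: r) * bump_weight z (c :: r) a = flow c r u) \/
  (flow c r u = 0 /\
   forall a, bumping (c :: r) a -> bumped (c :: r) a <> map val u).
Proof.
elim: r c u => [|m r IH] c [|x u] //= [szu].
  rewrite (size0nil szu); case: eqP => [->|xc].
    (* Position 2 is past the end, where [letter] returns [T], above every code. *)
    left; exists [:: 1; 2]%N; first by rewrite bumpingE /= /letter /= ltn_ord.
    rewrite bump_weight_path /= J_1 /= ltnn.
    by rewrite /J_ /= !mulr1 mulrC divfK // lt0r_neq0 ?ysum_gt0.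
  by right; split=> // a /bumping1 -> [/val_inj /esym].
case: eqP => [->|/eqP xm].
  have [[a [ba ea] <-]|[-> no_a]] := IH c u szu.
    left; case: a ba ea => [//|p b] ba ea.
    have p1 : p = 1%N by case/and4P: ba => /eqP.
    move: ba ea; rewrite {p}p1 => ba ea; have b2 := bumping_tail_ge2 ba.
    exists (1%N :: map S b); last exact: wt_skip.
    by rewrite skip_bumping ?bumped_skip ?ea.
  right; rewrite mulr0; split=> // a /bumpingP[b bb b2|b cm bb b2].
    by rewrite bumped_skip // => -[/no_a]; apply.
  by rewrite bumped_bump // => -[E]; rewrite E ltnn in cm.
case: andP => [[/eqP xc cm]|ncm].
  have [[a [ba ea] <-]|[-> no_a]] := IH m u szu.
    left; case: a ba ea => [//|p b] ba ea.
    have p1 : p = 1%N by case/and4P: ba => /eqP.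
    move: ba ea; rewrite {p}p1 => ba ea; have b2 := bumping_tail_ge2 ba.
    exists (1%N :: map S (1%N :: b)); last exact: wt_bump.
    by rewrite bump_bumping ?bumped_bump ?ea ?xc.
  right; rewrite mulr0; split=> // a /bumpingP[b bb b2|b _ bb b2].
    by rewrite bumped_skip // => -[/val_inj E]; rewrite E eqxx in xm.
  by rewrite bumped_bump // => -[_ /no_a]; apply.
right; split=> // a /bumpingP[b bb b2|b cm bb b2].
  by rewrite bumped_skip // => -[/val_inj E]; rewrite E eqxx in xm.
by rewrite bumped_bump // => -[/val_inj E]; case: ncm; rewrite -E eqxx.
Qed.

End Flow.

(** * Stationarity of [W] *)

Section Stationarity.

Variables (R : realFieldType) (z : nat -> R) (T : nat).
Hypothesis z_gt0 : forall i : nat, (0 < i)%N -> 0 < z i.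
Implicit Types (w r u : seq 'I_T) (c m x : 'I_T).

Lemma sum_tuple_cons (I : finType) n (F : seq I -> R) :
  \sum_(w : n.+1.-tuple I) F w = \sum_x \sum_(r : n.-tuple I) F (x :: r).
Proof.
rewrite pair_bigA /= (reindex (fun p : I * n.-tuple I => [tuple of p.1 :: p.2])) //=.
exists (fun v => (thead v, [tuple of behead v])) => [[x r] _|v _] /=.
  by congr (_, _); apply: val_inj.
by rewrite [RHS]tuple_eta.
Qed.

Lemma sum_flow n u : size u = n.+1 ->
  \sum_c \sum_(r : n.-tuple 'I_T) flow z c r u = wt z u.
Proof.
elim: n u => [|n IH] [|x u] // [szu].
  rewrite (size0nil szu) /= mulr1 ysum1 (bigD1 x) //= [X in _ + X]big1 => [|c cx].
    by rewrite addr0 (big_pred1 [tuple]) /= ?eqxx // => r; rewrite [r]tuple0 [RHS]eqxx.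
  by rewrite big1 // => r _; rewrite tuple0 /= eq_sym (negPf cx).
(* With [c :: r] a predecessor of the tail [u], [keep] and [swap] weigh its two extensions to
   predecessors of [x :: u]. *)
pose keep c r := ysum z (above x r).+1 * flow z c r u.
pose swap c r := if (x < c)%N then z (above x (c :: r)).+1 * flow z c r u else 0.
transitivity (\sum_c \sum_m \sum_(r : n.-tuple 'I_T)
    ((if m == x then keep c r else 0) + (if c == x then swap m r else 0))).
  apply: eq_bigr => c _; rewrite (sum_tuple_cons _ (fun r => flow z c r _)).
  apply: eq_bigr => m _; apply: eq_bigr => r _ /=; rewrite /keep /swap.
  rewrite [m == x]eq_sym [c == x]eq_sym; case: (x =P m) => [->|_].
    by rewrite ltnn if_same addr0.
  by rewrite add0r; case: (x =P c) => [->|].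
(* The test [m == x] collapses the sum over [m]; the test [c == x] collapses the sum over [c], and
   [m] is then renamed [c]. *)
transitivity (\sum_c \sum_(r : n.-tuple 'I_T) (keep c r + swap c r)).
  under eq_bigr => c _ do under eq_bigr => m _ do rewrite big_split /=.
  under eq_bigr => c _ do rewrite big_split /=.
  rewrite big_split /=; under [RHS]eq_bigr => c _ do rewrite big_split /=.
  rewrite [RHS]big_split /=; congr (_ + _).
    apply: eq_bigr => c _; rewrite (bigD1 x) //= eqxx [X in _ + X]big1 ?addr0 //.
    by move=> m /negPf ->; rewrite big1.
  rewrite (bigD1 x) //= eqxx [X in _ + X]big1 ?addr0 // => c /negPf ->.
  by rewrite big1 // => m _; rewrite big1.
rewrite /= -(IH u szu) mulr_sumr; apply: eq_bigr => c _; rewrite mulr_sumr.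
apply: eq_bigr => r _; rewrite /keep /swap.
(* A nonzero flow makes [c :: r] a rearrangement of [u], so [above x u] exceeds [above x r] by one
   exactly when [x < c], that is, when the exchange contributes. *)
have [->|/perm_flow/permP/(_ (fun y : 'I_T => x < y)%N)] := eqVneq (flow z c r u) 0.
  by rewrite !mulr0 if_same addr0.
rewrite -/(above x u) -/(above x (c :: r)) => <-; rewrite /= -/(above x r).
by case: (x < c)%N; rewrite ?addr0 // add1n [in RHS]ysumS mulrDl.
Qed.

Definition flow_word w u : R := if w is c :: r then flow z c r u else 0.

Lemma sum_flow_word n u : (0 < n)%N -> size u = n ->
  \sum_(w : n.-tuple 'I_T) flow_word w u = wt z u.
Proof.
by case: n => // n _ szu; rewrite (sum_tuple_cons _ (flow_word^~ u)) sum_flow.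
Qed.

Lemma flow_word_ge0 w u : 0 <= flow_word w u.
Proof. by case: w => [//|c r]; exact: flow_ge0. Qed.

Lemma perm_flow_word w u : flow_word w u != 0 -> perm_eq w u.
Proof. by case: w => [|c r]; rewrite /= ?eqxx //; exact: perm_flow. Qed.

Variable cnt : 'I_T -> nat.
Implicit Types s : St cnt.

Lemma size_word s : size (word s) = (\sum_t cnt t)%N.
Proof. by rewrite /word size_tuple. Qed.

Lemma count_word s t : count_mem t (word s) = cnt t.
Proof. by apply/eqP; have /forallP := valP s; exact. Qed.

Lemma word_inj : injective (@word T cnt).
Proof. by move=> s s' /val_inj/val_inj. Qed.

Lemma word_exists w : (forall t, count_mem t w = cnt t) ->
  exists s, word s = w.
Proof.
move=> cw; have sz : size w == (\sum_t cnt t)%N.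
  rewrite -sum1_size (partition_big id xpredT) //=; apply/eqP/eq_bigr => t _.
  by rewrite sum1_count cw.
have Pw : [forall t, count_mem t (Tuple sz) == cnt t].
  by apply/forallP => t; rewrite /= cw.
by exists (exist _ (Tuple sz) Pw).
Qed.

Lemma perm_word w s : perm_eq w (word s) -> exists s', word s' = w.
Proof.
by move=> /permP ps; apply: word_exists => t; rewrite ps count_word.
Qed.

Lemma sum_word (F : seq 'I_T -> R) :
  \sum_(s : St cnt) F (word s) =
  \sum_(w : (\sum_t cnt t).-tuple 'I_T | [forall t, count_mem t w == cnt t]) F w.
Proof.
rewrite [RHS](reindex_omap (val : St cnt -> _) insub) => [|w Pw].
  by apply: eq_bigl => s; rewrite (valP s) valK eqxx.
by rewrite insubT.
Qed.

Hypothesis cnt_gt0 : (0 < \sum_t cnt t)%N.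

(** [flowP] decides whether the filtered list is empty; if it is not, [bumped_inj] identifies its
    head with the sequence found. *)
Lemma wt_transition s s' :
  wt z (word s) * transition z s s' = flow_word (word s) (word s').
Proof.
rewrite /transition; have := size_word s; have szs' := size_word s'.
case Es : (word s) => [|c r] szs; first by move: cnt_gt0; rewrite -szs.
rewrite [flow_word _ _]/=.
have /(flowP z_gt0 c)[[a [ba ea] <-]|[-> no_a]] : size (word s') = (size r).+1.
- by rewrite szs'.
- case Ef : [seq _ <- _ | _] => [|a' f].
    suff: a \in [seq a <- bumping_seqs (c :: r) | bumped (c :: r) a ==
                                    [seq nat_of_ord t | t <- word s']].
      by rewrite Ef.
    by rewrite mem_filter mem_bumping_seqs ba ea eqxx.
  have : a' \in a' :: f by rewrite mem_head.
  rewrite -Ef mem_filter mem_bumping_seqs => /andP[/eqP ea' ba'].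
  by rewrite (bumped_inj ba' ba) // ea ea'.
- case Ef : [seq _ <- _ | _] => [|a' f]; first by rewrite mulr0.
  have : a' \in a' :: f by rewrite mem_head.
  by rewrite -Ef mem_filter mem_bumping_seqs => /andP[/eqP ea' /no_a].
Qed.

Lemma transition_ge0 s s' : 0 <= transition z s s'.
Proof.
by rewrite -(pmulr_rge0 _ (wt_gt0 z_gt0 (word s))) wt_transition flow_word_ge0.
Qed.

Lemma wt_stationary s' :
  \sum_(s : St cnt) wt z (word s) * transition z s s' = wt z (word s').
Proof.
under eq_bigr => s _ do rewrite wt_transition.
rewrite (sum_word (flow_word^~ _)) -(sum_flow_word cnt_gt0 (size_word s')).
(* Among all words of this length, those of another content send no flow to [s']. *)
rewrite [RHS](bigID [pred w : _.-tuple _ | [forall t, count_mem t w == cnt t]]) /=.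
rewrite [X in _ + X]big1 ?addr0 // => w; apply: contraNeq => /perm_flow_word/permP p.
by apply/forallP => t; rewrite p count_word.
Qed.

End Stationarity.

(** * Bubble sort passes *)

Section Bubble.

Variable T : nat.
Implicit Types (w r u : seq 'I_T) (c m x h : 'I_T).

(** The head of the result acts as the carried letter: it is exchanged with [x] exactly when it is
    larger, so a smallest letter ends up in front. *)
Fixpoint bubble u : seq 'I_T :=
  if u is x :: u' then
    if bubble u' is h :: r then
      if (x < h)%N then [:: x, h & r] else [:: h, x & r]
    else [:: x]
  else [::].

Lemma perm_bubble u : perm_eq (bubble u) u.
Proof.
elim: u => [//|x u] /=; case: (bubble u) => [|h r].
  by move/perm_size/esym/size0nil ->.
rewrite -(perm_cons x) => IH; case: ifP => // _; apply: perm_trans IH.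
by rewrite (perm_catCA [:: h] [:: x]).
Qed.

Lemma perm_iter_bubble n u : perm_eq (iter n bubble u) u.
Proof. by elim: n => [//|n IH]; exact: perm_trans (perm_bubble _) IH. Qed.

Lemma bubble_head h r u : bubble u = h :: r -> all (fun y : 'I_T => h <= y)%N u.
Proof.
elim: u h r => [//|x u IH] h r /=; case E : (bubble u) => [|k s].
  by move: (perm_bubble u); rewrite E => /perm_size/esym/size0nil -> [-> _];
     rewrite /= leqnn.
have {}IH := IH _ _ E; case: ltnP => [xk|kx] [<- _]; rewrite ?leqnn ?kx //=.
by apply: sub_all IH => y; apply: leq_trans (ltnW xk).
Qed.

Lemma bubble_min x u :
  all (fun y : 'I_T => x <= y)%N u -> bubble (x :: u) = x :: bubble u.
Proof.
rewrite -(perm_all _ (perm_bubble u)) /=; case: (bubble u) => [//|h r] /= /andP[xh _].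
case: ltnP => // hx; suff -> : h = x by [].
by apply/val_inj/anti_leq; rewrite hx.
Qed.

Lemma iter_bubble_min n x u : all (fun y : 'I_T => x <= y)%N u ->
  iter n bubble (x :: u) = x :: iter n bubble u.
Proof.
move=> xu; elim: n => [//|n IH].
by rewrite !iterS IH bubble_min // (perm_all _ (perm_iter_bubble _ _)).
Qed.

(** The first pass puts a minimum in front, where later passes leave it while they sort the tail. *)
Lemma iter_bubble_sorted n u : (size u <= n)%N ->
  sorted (fun x y : 'I_T => x <= y)%N (iter n bubble u).
Proof.
elim: n u => [|n IH] u szu; first by case: u szu.
rewrite iterSr; have pu := perm_bubble u; have := perm_size pu.
case E : (bubble u) => [|h r] szb.
  have -> : iter n bubble [::] = [::] by elim: n {IH szu} => //= n ->.
  by [].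
have hr : all (fun y : 'I_T => h <= y)%N r.
  have := bubble_head E; rewrite -(perm_all _ pu) E => /andP[_].
  exact.
rewrite iter_bubble_min //= path_sortedE; last first.
  by move=> x y t; exact: leq_trans.
rewrite (perm_all _ (perm_iter_bubble _ _)) hr IH //.
by rewrite -ltnS (leq_trans _ szu) // -szb.
Qed.

(** When [x < h] the pass takes the exchange branch of [flow], otherwise the keeping one; both
    coefficients are positive. *)
Lemma flow_bubble_gt0 (R : realFieldType) (z : nat -> R) u :
  (forall i : nat, (0 < i)%N -> 0 < z i) -> (0 < size u)%N ->
  0 < flow_word z (bubble u) u.
Proof.
move=> z_gt0; elim: u => [//|x u IH] _ /=.
case: u IH => [_|x' u]; first by rewrite /= eqxx z_gt0.
move=> /(_ isT); case: (bubble _) => [|h r]; first by rewrite ltxx.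
move: (x' :: u) => {x'}u /= fl; case: ltnP => [xh|_] /=.
  have /negPf -> : x != h by apply: contraTneq xh => ->; rewrite ltnn.
  by rewrite eqxx xh mulr_gt0 ?z_gt0.
by rewrite eqxx mulr_gt0 ?ysum_gt0.
Qed.

End Bubble.

Arguments bubble {T} u.

(** * Uniqueness by a minimum principle *)

Section Uniqueness.

Variables (R : realFieldType) (z : nat -> R) (T : nat) (cnt : 'I_T -> nat).
Hypothesis z_gt0 : forall i : nat, (0 < i)%N -> 0 < z i.
Hypothesis cnt_gt0 : (0 < \sum_t cnt t)%N.
Implicit Types s : St cnt.

(** Stationarity of [wt * h], that is, harmonicity of [h] for the chain reversed with respect to
    [wt]. *)
Definition harmonic (h : St cnt -> R) : Prop :=
  forall s', \sum_s wt z (word s) * h s * transition z s s' = wt z (word s') * h s'.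

(** The minimal value [h s'] is an average of [h] over the predecessors of [s'], so every
    predecessor of positive weight attains it. *)
Lemma harmonic_min_bubble h s0 s s' : harmonic h ->
  (forall t, h s0 <= h t) -> h s' = h s0 -> word s = bubble (word s') ->
  h s = h s0.
Proof.
move=> hh h_min hs' ws; apply/eqP; rewrite -subr_eq0.
have fl : 0 < wt z (word s) * transition z s s'.
  by rewrite wt_transition // ws flow_bubble_gt0 // size_word.
(* These terms are nonnegative and sum to 0, because [wt] itself is stationary. *)
pose F t := (h t - h s0) * (wt z (word t) * transition z t s').
suff : F s = 0 by rewrite /F => /eqP; rewrite mulf_eq0 [_ * _ == 0]gt_eqF // orbF.
apply: (psumr_eq0P (P := xpredT)) => // [t _|].
  rewrite mulr_ge0 ?subr_ge0 // mulr_ge0 ?transition_ge0 //.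
  by rewrite ltW // wt_gt0.
under eq_bigr => t _ do rewrite /F mulrBl.
rewrite sumrB -mulr_sumr wt_stationary //.
under eq_bigr => t _ do rewrite mulrA [h t * _]mulrC.
by rewrite hh hs' mulrC subrr.
Qed.

Lemma harmonic_min_iter h s0 s n : harmonic h -> (forall t, h s0 <= h t) ->
  word s = iter n bubble (word s0) -> h s = h s0.
Proof.
move=> hh h_min; elim: n s => [|n IH] s; first by move/word_inj ->.
have [s' ws'] := perm_word (perm_iter_bubble n (word s0)).
move=> /= ws; apply: (harmonic_min_bubble hh h_min (IH s' ws')).
by rewrite ws ws'.
Qed.

Lemma sorted_word_exists s0 :
  exists s, sorted (fun x y : 'I_T => x <= y)%N (word s).
Proof.
have [s ws] := perm_word (perm_iter_bubble (size (word s0)) (word s0)).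
by exists s; rewrite ws iter_bubble_sorted.
Qed.

(** Bubble passes lead from any minimizer to the sorted word, which is unique for the given
    content. *)
Lemma harmonic_sorted_le h s t : harmonic h ->
  sorted (fun x y : 'I_T => x <= y)%N (word s) -> h s <= h t.
Proof.
move=> hh ss; have [s0 _ h_min] := @Order.TotalTheory.arg_minP _ R _ t xpredT h isT.
rewrite -[h s](_ : h s0 = _); first exact: h_min.
apply/esym; apply: (@harmonic_min_iter h s0 s (size (word s0))) => // [u|].
  exact: h_min.
apply: (sorted_eq (leT := (fun x y : 'I_T => x <= y)%N)) => //.
- by move=> x y v; exact: leq_trans.
- by move=> x y xy; apply/val_inj/anti_leq.
- exact: iter_bubble_sorted.
rewrite perm_sym (perm_trans (perm_iter_bubble _ _)) //.
by apply/allP => x _ /=; rewrite !count_word.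
Qed.

Lemma harmonic_const h s t : harmonic h -> h s = h t.
Proof.
move=> hh; have hNh : harmonic (fun s => - h s).
  move=> s'; rewrite mulrN -hh -sumrN; apply: eq_bigr => u _.
  by rewrite mulrN mulNr.
have [s0 ss0] := sorted_word_exists s.
have eq0 u : h u = h s0.
  apply/le_anti; rewrite (harmonic_sorted_le u hh ss0) andbT -lerN2.
  exact: (harmonic_sorted_le u hNh ss0).
by rewrite !eq0.
Qed.

End Uniqueness.

(** * Complete homogeneous symmetric polynomials *)

Section CompleteHomogeneous.

Variables (R : realFieldType) (x : nat -> R).

Lemma hsym0 m : hsym 0 m x = 1.
Proof.
rewrite /hsym (big_pred1 [tuple]) ?big_nil // => s.
by rewrite [s]tuple0 [RHS]eqxx.
Qed.

Lemma hsymS0 l : hsym l.+1 0 x = 0.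
Proof. by rewrite /hsym big1 // => s _; case: (thead s). Qed.

Lemma sorted_leq_rcons (t : seq nat) y :
  sorted leq (rcons t y) = all (leq^~ y) t && sorted leq t.
Proof. by rewrite !(sorted_pairwise leq_trans) pairwise_rcons. Qed.

Lemma hsym_notin_max l m :
  \sum_(s : l.+1.-tuple 'I_m.+1 | sorted leq [seq nat_of_ord i | i <- s]
                                  && (ord_max \notin s))
    \prod_(i <- s) x i.+1 = hsym l.+1 m x.
Proof.
(* [inord] needs a nonempty target, so [m = 0] is treated apart; both sides are then 0. *)
case: m => [|m].
  rewrite hsymS0 big1 // => s /andP[_ /negP[]].
  by rewrite [s]tuple_eta inE [ord_max]ord1 [thead s]ord1 eqxx.
pose up (s : l.+1.-tuple 'I_m.+1) := map_tuple (widen_ord (leqnSn m.+1)) s.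
pose down (s : l.+1.-tuple 'I_m.+2) :=
  map_tuple (fun i : 'I_m.+2 => inord i : 'I_m.+1) s.
rewrite (reindex_onto up down) => [|s /andP[_ s_max]].
  apply: eq_big => s; last by move=> _; rewrite big_map.
  have -> : down (up s) == s.
    apply/eqP/val_inj; rewrite /= -map_comp -[RHS]map_id; apply: eq_map => i /=.
    exact: inord_val.
  rewrite andbT /= -map_comp /= andb_idr // => _.
  apply/mapP => -[i _ /(congr1 val) /= E].
  by have := ltn_ord i; rewrite -E ltnn.
apply: val_inj; rewrite /= -map_comp -[RHS]map_id; apply/eq_in_map => i si /=.
apply/val_inj; rewrite /= inordK // ltn_neqAle -ltnS ltn_ord andbT.
by apply: contraNneq s_max => E; rewrite (_ : ord_max = i) //; apply/val_inj.
Qed.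

(** In a weakly increasing tuple the largest index, if present, comes last; deleting that entry is a
    bijection. *)
Lemma hsym_in_max l m :
  \sum_(s : l.+1.-tuple 'I_m.+1 | sorted leq [seq nat_of_ord i | i <- s]
                                  && (ord_max \in s))
    \prod_(i <- s) x i.+1 = x m.+1 * hsym l m.+1 x.
Proof.
pose ext (s : l.-tuple 'I_m.+1) := [tuple of rcons s ord_max].
pose res (s : l.+1.-tuple 'I_m.+1) : l.-tuple 'I_m.+1 :=
  [tuple of belast (thead s) (behead s)].
rewrite (reindex_onto ext res) => [|s /andP[srt s_max]].
  rewrite mulr_sumr; apply: eq_big => s.
    have -> : res (ext s) == s.
      apply/eqP/val_inj => /=; have /= := tuple_eta (ext s) => /(congr1 val) /=.
      by rewrite lastI => /rcons_inj[].
    rewrite andbT /= mem_rcons mem_head andbT map_rcons sorted_leq_rcons andb_idl //.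
    by move=> _; apply/allP => _ /mapP[i _ ->] /=; rewrite -ltnS ltn_ord.
  by move=> _; rewrite /= -cats1 big_cat big_seq1 mulrC.
case/tupleP: s srt s_max => y t; rewrite /= => srt s_max.
apply: val_inj; rewrite /= theadE; move: srt s_max.
rewrite -[path _ _ _]/(sorted leq (map (@nat_of_ord _) (y :: t))).
rewrite -[_ \in _]/(ord_max \in y :: tval t) lastI map_rcons.
rewrite sorted_leq_rcons => /andP[le_last _].
rewrite mem_rcons inE => /predU1P[<- //|].
move=> /(map_f (@nat_of_ord _)) /(allP le_last) /= lm.
congr rcons; apply/val_inj/anti_leq; rewrite lm /= -ltnS.
exact: ltn_ord.
Qed.

Lemma hsymSS l m :
  hsym l.+1 m.+1 x = hsym l.+1 m x + x m.+1 * hsym l m.+1 x.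
Proof.
rewrite -(hsym_notin_max l m) -hsym_in_max addrC.
by rewrite /hsym (bigID [pred s : _.-tuple _ | ord_max \in s]).
Qed.

Lemma hsym_gt0 l m : (forall i, 0 < x i.+1) -> 0 < hsym l m.+1 x.
Proof.
move=> x_gt0; elim: l => [|l IH]; first by rewrite hsym0.
rewrite hsymSS addrC ltr_pwDl ?mulr_gt0 //.
by apply: sumr_ge0 => s _; apply: prodr_ge0 => i _; exact: ltW.
Qed.

End CompleteHomogeneous.

(** The factors [A i] are replaced by [B i] one at a time, from index 0 up; each summand accounts
    for one replacement. *)
Lemma sum_telescope (R : comPzRingType) n (A B : 'I_n -> R) :
  \sum_i (A i - B i) * ((\prod_(j < n | (i < j)%N) A j)
                        * \prod_(j < n | (j < i)%N) B j) =
  \prod_i A i - \prod_i B i.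
Proof.
elim: n A B => [|n IH] A B; first by rewrite !big_ord0 subrr.
have recl (F : 'I_n.+1 -> R) (P : pred nat) : \prod_(j < n.+1 | P j) F j =
    (if P 0 then F ord0 else 1) * \prod_(j < n | P j.+1) F (lift ord0 j).
  by rewrite big_mkcond big_ord_recl /= -big_mkcond.
pose A' i := A (lift ord0 i); pose B' i := B (lift ord0 i).
rewrite !big_ord_recl /= [\prod_(j < _ | (_ < 0)%N) _]big_pred0 // mulr1.
rewrite (recl A (leq 1)) mul1r.
transitivity ((A ord0 - B ord0) * \prod_i A' i
              + B ord0 * (\prod_i A' i - \prod_i B' i)).
  rewrite -IH mulr_sumr; congr (_ + _); apply: eq_bigr => i _.
  rewrite (recl A (leq (bump 0 i).+1)) (recl B (fun j => j < bump 0 i)%N) mul1r.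
  by rewrite [X in _ * X = _]mulrCA [LHS]mulrCA.
by rewrite mulrBl mulrBr addrA subrK.
Qed.

(** * The normalizing constant *)

Section Normalization.

Variables (R : realFieldType) (z : nat -> R) (T : nat).

(** [(beyond cnt t).+1] is the number of variables of the factor of [t] in [Zpart], written there
    with a subtraction. *)
Definition beyond (cnt : 'I_T -> nat) (t : 'I_T) : nat :=
  (\sum_(s : 'I_T | t < s) cnt s)%N.

Lemma above_count (t : 'I_T) w : above t w = beyond (fun s => count_mem s w) t.
Proof.
rewrite /beyond; elim: w => [|x w IH] /=; first by rewrite big1.
rewrite big_split /= -IH; congr (_ + _)%N.
by rewrite big_mkcond (bigD1 x) //= eqxx big1 ?addn0 => [|s /negPf];
  case: ifP; rewrite // eq_sym => _ ->.
Qed.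

(** The largest letter present has none beyond it, so its factor has positive degree in no variables
    and vanishes. *)
Lemma prod_hsym_eq0 (cnt : 'I_T -> nat) : (0 < \sum_t cnt t)%N ->
  \prod_t hsym (cnt t) (beyond cnt t) (ysum z) = 0.
Proof.
rewrite lt0n sum_nat_eq0 negb_forall => /existsP[t0 /= ct0].
have [t ct t_max] := @arg_maxnP _ t0 (fun t => cnt t != 0)%N (fun t => t) ct0.
rewrite (bigD1 t) //= /beyond big1 => [|s ts].
  by case: (cnt t) ct => // k _; rewrite hsymS0 mul0r.
by apply/eqP; apply: contraTT ts => /t_max; rewrite -leqNgt.
Qed.

Lemma sum_wt n (cnt : 'I_T -> nat) : (\sum_t cnt t = n)%N ->
  \sum_(w : n.-tuple 'I_T | [forall t, count_mem t w == cnt t]) wt z w =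
  \prod_t hsym (cnt t) (beyond cnt t).+1 (ysum z).
Proof.
elim: n cnt => [|n IH] cnt sz.
  have c0 t : cnt t = 0%N.
    by apply/eqP; move/eqP: sz; rewrite sum_nat_eq0 => /forallP/(_ t).
  rewrite [RHS]big1 => [|t _]; last by rewrite c0 hsym0.
  rewrite (big_pred1 [tuple]) // => w; rewrite [w]tuple0 [RHS]eqxx.
  by apply/forallP => t; rewrite c0.
have := prod_hsym_eq0; move=> /(_ cnt); rewrite sz => /(_ isT) B0.
(* Subtracting the vanishing product turns the right side into a telescoping sum, matched term by
   term with the first letter [x]. *)
rewrite -[RHS]subr0 -[X in _ = _ - X]B0 -sum_telescope big_mkcond /=.
rewrite (sum_tuple_cons _
  (fun w => if [forall t, count_mem t w == cnt t] then wt z w else 0)).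
(* If [x] does not occur, both of its factors are 1 and no word starts with [x]. *)
apply: eq_bigr => x _; case Ex : (cnt x) => [|k].
  rewrite !hsym0 subrr mul0r big1 // => r _; case: ifP => // /forallP/(_ x).
  by rewrite Ex /= eqxx.
rewrite hsymSS addrAC subrr add0r.
pose cnt' t := (cnt t - (x == t))%N.
have cntE t : cnt t = ((x == t) + cnt' t)%N.
  by rewrite /cnt' subnKC //; case: eqP => [<-|//]; rewrite Ex.
have sz' : (\sum_t cnt' t = n)%N.
  apply/succn_inj; rewrite -sz -add1n; under [RHS]eq_bigr do rewrite cntE.
  rewrite big_split /=; congr (_ + _)%N.
  rewrite (bigD1 x) //= eqxx big1 // => t /negPf.
  by rewrite eq_sym => ->.
(* Removing one [x] lowers [beyond] by one exactly below [x], so there the factors with one variable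
   fewer are those of the new content. *)
have bey t : beyond cnt t = ((t < x)%N + beyond cnt' t)%N.
  rewrite /beyond; under eq_bigr do rewrite cntE; rewrite big_split /=; congr (_ + _)%N.
  rewrite big_mkcond (bigD1 x) //= eqxx big1 ?addn0 => [|s /negPf].
    by case: ifP.
  by rewrite eq_sym => ->; case: ifP.
have bx : beyond cnt' x = beyond cnt x by rewrite [RHS]bey ltnn.
transitivity (ysum z (beyond cnt x).+1 *
    \sum_(r : n.-tuple 'I_T | [forall t, count_mem t r == cnt' t]) wt z r).
  rewrite [in RHS]big_mkcond mulr_sumr; apply: eq_bigr => r _ /=.
  have -> : [forall t, ((x == t) + count_mem t r)%N == cnt t] =
            [forall t, count_mem t r == cnt' t].
    by apply: eq_forallb => t; rewrite cntE eqn_add2l.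
  case: ifP => [/forallP cr|]; last by rewrite mulr0.
  rewrite above_count -bx /beyond; congr (ysum z _.+1 * _).
  by apply: eq_bigr => s _; apply/eqP.
rewrite IH // -mulrA; congr (_ * _); rewrite (bigD1 x) //=; congr (_ * _).
  by rewrite bx /cnt' eqxx Ex subn1.
rewrite (bigID (fun s : 'I_T => (x < s)%N)) /=; congr (_ * _).
  apply: eq_big => [s|s /andP[sx xs]].
    by rewrite andb_idl // => xs; apply: contraTneq xs => ->; rewrite ltnn.
  by rewrite cntE bey eq_sym (negPf sx) ltnNge (ltnW xs).
apply: eq_big => [s|s /andP[sx]].
  by rewrite -leqNgt ltn_neqAle.
rewrite -leqNgt => xs; have lt_sx : (s < x)%N by rewrite ltn_neqAle xs andbT.
by rewrite cntE bey eq_sym (negPf sx) lt_sx.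
Qed.

Lemma sum_wt_St (cnt : 'I_T -> nat) :
  \sum_(s : St cnt) wt z (word s) = Zpart z cnt.
Proof.
rewrite (sum_word cnt (@wt _ z T)) sum_wt //; apply: eq_bigr => i _.
congr (hsym _ _.+1 _); rewrite [X in (X - _)%N](bigID (fun t : 'I_T => (t <= i)%N)) /=.
by rewrite addKn; apply: eq_bigl => t; rewrite ltnNge.
Qed.

End Normalization.

Theorem theorem2p4 (R : realFieldType) (T : nat) (c : 'I_T -> nat)
    (z : nat -> R) (T_gt0 : (0 < T)%N) (c_gt0 : forall t : 'I_T, (0 < c t)%N)
    (z_gt0 : forall i : nat, (0 < i)%N -> 0 < z i) :
  forall pi : St c -> R,
    stationary_distribution (transition z (c := c)) pi <->
    forall w : St c,
      pi w = (Zpart z c)^-1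
             * \prod_(1 <= i < (\sum_t c t)%N.+1) ysum z (E_ (word w) i).
Proof.
move=> pi; have n_gt0 : (0 < \sum_t c t)%N.
  by rewrite (bigD1 (Ordinal T_gt0)) //= addn_gt0 c_gt0.
have Z_gt0 : 0 < Zpart z c.
  by apply: prodr_gt0 => i _; apply: hsym_gt0 => j; exact: ysum_gt0.
have Wgt0 (w : St c) : 0 < wt z (word w) by exact: wt_gt0.
have prodE (w : St c) :
    \prod_(1 <= i < (\sum_t c t)%N.+1) ysum z (E_ (word w) i) = wt z (word w).
  by rewrite -(size_word w) prod_E.
split=> [[pi_ge0 pi_sum pi_stat] w|piE].
  (* The density of [pi] with respect to [wt]; stationarity of [pi] makes it harmonic. *)
  pose h w := pi w / wt z (word w).
  have piE w' : pi w' = h w' * wt z (word w') by rewrite /h divfK ?gt_eqF.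
  have hh : harmonic z h.
    move=> s'; rewrite mulrC -piE -pi_stat; apply: eq_bigr => s _.
    by rewrite (mulrC _ (h s)) -piE.
  (* Since [h] is constant, total mass 1 forces its value to be the inverse of [Zpart z c]. *)
  rewrite prodE piE; congr (_ * _); apply: (mulIf (x := Zpart z c)); rewrite ?gt_eqF //.
  rewrite mulVf ?gt_eqF // -pi_sum -sum_wt_St mulr_sumr; apply: eq_bigr => s _.
  by rewrite piE (harmonic_const z_gt0 n_gt0 s w hh).
have {}piE w : pi w = (Zpart z c)^-1 * wt z (word w) by rewrite piE prodE.
split=> [w||s'].
- by rewrite piE mulr_ge0 ?invr_ge0 // ltW.
- under eq_bigr do rewrite piE.
  by rewrite -mulr_sumr sum_wt_St mulVf ?gt_eqF.
under eq_bigr do rewrite piE -mulrA.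
by rewrite -mulr_sumr wt_stationary // piE.
Qed.
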